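(* Let $\mathbb{W}$ and $\mathbb{V}$ be any two disjoint sets with $\mathbb{W}\uplus\mathbb{V}=\mathbb{X}$. Any RFS density $\pi(X)$ on $\mathbb{X}$ can be decomposed as $$\pi(X)=\pi_V(X\cap\mathbb{V}\mid X\cap\mathbb{W})\;\pi_W(X\cap\mathbb{W}),$$ where $\pi_W$ is the marginal density on $\mathbb{W}$ and $\pi_V(\cdot\mid\cdot)$ is the conditional density on $\mathbb{V}$.
   Context: A random finite set (RFS) on $\mathbb{X}$ is a random variable taking values in the finite subsets $\mathcal{F}(\mathbb{X})$ of $\mathbb{X}$ (a Euclidean state space with Lebesgue measure). An RFS density is a function $\pi:\mathcal{F}(\mathbb{X})\to[0,\infty)$ in the sense of finite set statistics, with $\Pr(X\subseteq A)=\int_A\pi(X)\,\delta X$ for measurable $A$, where $\int_A f(X)\,\delta X=\sum_{n=0}^{\infty}\frac{1}{n!}\int_{A^n}f(\{x_1,\dots,x_n\})\,dx_1\cdots dx_n$; in particular $\int_{\mathbb{X}}\pi(X)\,\delta X=1$. As usual, densities are functions determined up to null sets. For a function $h$ and finite $X$, $[h]^X=\prod_{x\in X}h(x)$, $[h]^\emptyset=1$; $1_{\mathbb{W}}$ is the indicator function of $\mathbb{W}$. Marginal density (the density of $X\cap\mathbb{W}$): $\pi_W(X)=[1_{\mathbb{W}}]^{X}\int_{\mathbb{V}}\pi(X\cup X')\,\delta X'$. Conditional density (of $X\cap\mathbb{V}$ given $X\cap\mathbb{W}$): if $\pi_W(X)\neq 0$, $$\pi_V(X'\mid X)=\frac{[1_{\mathbb{W}}]^{X}[1_{\mathbb{V}}]^{X'}\pi(X'\cup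 X)}{\pi_W(X)},$$ and, by convention, $\pi_V(X'\mid X)=1$ if $\pi_W(X)=0$. *)

(* Defs.v *)
From HB Require Import structures.
From mathcomp Require Import all_boot all_order all_algebra.
From mathcomp Require Import finmap.
From mathcomp Require Import all_classical all_reals all_analysis.

Set Implicit Arguments.
Unset Strict Implicit.
Unset Printing Implicit Defensive.

Import Order.TTheory GRing.Theory Num.Theory.
Import numFieldNormedType.Exports.

Local Open Scope classical_set_scope.
Local Open Scope ring_scope.
Local Open Scope ereal_scope.

Section power_measure.
Context (dT : measure_display) (T : measurableType dT) (R : realType).
Variable mu : {sigma_finite_measure set T -> \bar R}.

Definition pair_cons n (p : T * n.-tuple T) : n.+1.-tuple T :=
  [tuple of p.1 :: p.2].

Lemma measurable_pair_cons n : measurable_fun setT (@pair_cons n).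
Proof. exact: measurable_cons. Qed.

Definition pair_uncons n (t : n.+1.-tuple T) : T * n.-tuple T :=
  (thead t, [tuple of behead t]).

Lemma pair_consK n : cancel (@pair_cons n) (@pair_uncons n).
Proof.
by case=> x t; rewrite /pair_cons /pair_uncons theadE; congr pair; exact: val_inj.
Qed.

Lemma pair_unconsK n : cancel (@pair_uncons n) (@pair_cons n).
Proof. by move=> t; rewrite /pair_cons /pair_uncons [RHS]tuple_eta. Qed.

Lemma measurable_pair_uncons n : measurable_fun setT (@pair_uncons n).
Proof.
apply: measurable_fun_pair; first exact: measurable_tnth.
exact: measurable_behead.
Qed.

Section cons_measure.
Variables (n : nat) (nu : {sigma_finite_measure set (n.-tuple T) -> \bar R}).

Definition cons_measure : set (n.+1.-tuple T) -> \bar R :=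
  pushforward (mu \x nu) (@pair_cons n).

Let measurable_preimage_pair_cons A :
  measurable A -> measurable (@pair_cons n @^-1` A).
Proof.
by move=> mA; rewrite -[X in measurable X]setTI; exact: measurable_pair_cons.
Qed.

Let cons_measure0 : cons_measure set0 = 0.
Proof. by rewrite /cons_measure /pushforward preimage_set0 measure0. Qed.

Let cons_measure_ge0 A : 0 <= cons_measure A.
Proof. by rewrite /cons_measure /pushforward; exact: measure_ge0. Qed.

Let cons_measure_semi_sigma_additive : semi_sigma_additive cons_measure.
Proof.
move=> F mF tF mUF; rewrite /cons_measure /pushforward preimage_bigcup.
apply: measure_semi_sigma_additive.
- by move=> i; exact: measurable_preimage_pair_cons.
- apply/trivIsetP => /= i j _ _ ij; rewrite -preimage_setI.
  by move/trivIsetP : tF => /(_ _ _ _ _ ij) ->//; rewrite preimage_set0.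
- by rewrite -preimage_bigcup; exact: measurable_preimage_pair_cons.
Qed.

HB.instance Definition _ := isMeasure.Build _ _ _ cons_measure
  cons_measure0 cons_measure_ge0 cons_measure_semi_sigma_additive.

Lemma cons_measure_sigma_finite : sigma_finite setT cons_measure.
Proof.
have /sigma_finiteP[F [TF ndF Foo]] := sigma_finiteT mu.
have /sigma_finiteP[G [TG ndG Goo]] := sigma_finiteT nu.
exists (fun i => @pair_uncons n @^-1` (F i `*` G i)).
  apply/esym; rewrite -subTset => t _.
  have [i _ Fi] : (\bigcup_i F i) (pair_uncons t).1 by rewrite -TF.
  have [j _ Gj] : (\bigcup_i G i) (pair_uncons t).2 by rewrite -TG.
  exists (maxn i j) => //; split => /=.
    by move: Fi; exact/subsetPset/ndF/leq_maxl.
  by move: Gj; exact/subsetPset/ndG/leq_maxr.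
move=> i; have [mF Fi] := Foo i; have [mG Gi] := Goo i; split.
  rewrite -[X in measurable X]setTI; apply: measurable_pair_uncons => //.
  exact: measurableX.
rewrite /cons_measure /pushforward -comp_preimage.
rewrite (_ : _ \o _ = id); last by apply/funext => p; exact: pair_consK.
by rewrite preimage_id product_measure1E// lte_mul_pinfty// ge0_fin_numE.
Qed.

HB.instance Definition _ :=
  Measure_isSigmaFinite.Build _ _ _ cons_measure cons_measure_sigma_finite.

End cons_measure.

(* The [n]-fold product measure of [mu] on [n.-tuple T]; for [n = 0] it is the
   unit mass on the one-point space [0.-tuple T]. *)
Fixpoint power_measure n : {sigma_finite_measure set (n.-tuple T) -> \bar R} :=
  match n with
  | 0 => \d_([tuple] : 0.-tuple T)
  | n'.+1 => cons_measure (power_measure n')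
  end.

End power_measure.
Section random_finite_sets.
Variables (R : realType) (d : nat).

Definition euclidean : measurableType _ := d.-tuple (measurableTypeR R).
Local Notation E := euclidean.

Definition euclidean_lebesgue : {sigma_finite_measure set E -> \bar R} :=
  power_measure (@lebesgue_measure R) d.

Definition lebesgue_power n : {sigma_finite_measure set (n.-tuple E) -> \bar R} :=
  power_measure euclidean_lebesgue n.

Definition points n (t : n.-tuple E) : {fset E} := [fset x in (t : seq E)]%fset.

Definition set_integral (A : set E) (f : {fset E} -> \bar R) : \bar R :=
  \sum_(0 <= n <oo) ((n`!%:R)^-1)%:E *
    \int[lebesgue_power n]_(t in [set t | forall i, A (tnth t i)]) f (points t).

(* The null sets are those of the set integral: a property holds for almost
   every finite set when, for every [n], it holds for [{x_1, ..., x_n}] for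
   Lebesgue almost every [(x_1, ..., x_n)]; for [n = 0] this means exactly at
   the empty set. *)
Definition ae_finset (Q : {fset E} -> Prop) : Prop :=
  forall n, {ae lebesgue_power n, forall t, Q (points t)}.

(* The sigma-algebra on finite sets generated by the events [X `<=` A]. *)
Definition inclusion_events : set (set {fset E}) :=
  [set [set X : {fset E} | [set` X] `<=` A] | A in measurable].

Definition finset_space : measurableType _ :=
  g_sigma_algebraType inclusion_events.

Definition is_rfs_density (dO : measure_display) (Omega : measurableType dO)
    (P : probability Omega R) (X : {RV P >-> finset_space})
    (pi : {fset E} -> R) : Prop :=
  [/\ forall S, (0 <= pi S)%R,
      forall n, measurable_fun setT (fun t : n.-tuple E => pi (points t)) &
      forall A : set E, measurable A ->
        P [set w | [set` (X w : {fset E})] `<=` A] =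
          set_integral A (fun S => (pi S)%:E)].

Definition set_power (h : E -> R) (X : {fset E}) : R := (\prod_(x <- X) h x)%R.

Definition fset_restrict (X : {fset E}) (A : set E) : {fset E} :=
  [fset x in X | x \in A]%fset.

(* Valued in [\bar R]: for a density [pi] the integral is finite for almost
   every [X], but it may diverge on a null set. *)
Definition marginal_density (W V : set E) (pi : {fset E} -> R)
    (X : {fset E}) : \bar R :=
  (set_power \1_W X)%:E * set_integral V (fun X' => (pi (X `|` X')%fset)%:E).

Definition conditional_density (W V : set E) (pi : {fset E} -> R)
    (X' X : {fset E}) : \bar R :=
  if marginal_density W V pi X == 0 then 1
  else (set_power \1_W X * set_power \1_V X' * pi (X' `|` X)%fset)%:E
         / marginal_density W V pi X.

End random_finite_sets.

(* Main.v *)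
Require Import Defs.
From HB Require Import structures.
From mathcomp Require Import all_boot all_order all_algebra.
From mathcomp Require Import finmap.
From mathcomp Require Import all_classical all_reals all_analysis.
From mathcomp Require Import measurable_realfun.
From mathcomp Require Import ring.

Set Implicit Arguments.
Unset Strict Implicit.
Unset Printing Implicit Defensive.

Import Order.TTheory GRing.Theory Num.Theory.

Local Open Scope classical_set_scope.
Local Open Scope ring_scope.
Local Open Scope ereal_scope.

(* Wherever the marginal density g(S) at S `&` W is neither 0 nor +oo, the
   identity is a cancellation; so it suffices that the function f equal to pi
   where g is 0 or +oo, and to 0 elsewhere, vanishes almost everywhere.
   Let T_A F be the set function S |-> \int_(x in A) F({x} `|` S), so that
   integrating F over the n-tuples of points of A is evaluating T_A^n F at the
   empty set. By Fubini T_W and T_V commute, and T_(W `|` V) = T_W + T_V; hence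
   all integrals of F over n-tuples are binomial combinations of the numbers
   T_W^k T_V^m F at the empty set.
   For pi, this bounds \int_(W^k) g by k! times the total mass 1, so g is almost
   everywhere finite on W^k. For f, integrating first over V^m gives 0 at every
   point of W^k where g is finite (if g = 0 then so is each integral of pi over
   V^m), so every T_W^k T_V^m f, hence every T_(W `|` V)^n f, vanishes at the
   empty set. *)

Lemma measurable_mem dT (T : measurableType dT) (A : set T) :
  measurable A -> measurable_fun setT (fun x => x \in A).
Proof.
move=> mA; apply: (measurable_fun_bool true).
by rewrite setTI preimage_mem_true.
Qed.

(** * Measurable functions of finite sets and the operators [point_integral A] *)

Section finset_functions.
Variables (R : realType) (d : nat).
Local Notation E := (euclidean R d).
Local Notation mu := (@euclidean_lebesgue R d).
Implicit Types (F G : {fset E} -> \bar R) (S : {fset E}) (A B : set E).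

Definition tuples_in n A : set (n.-tuple E) := [set t | forall i, A (tnth t i)].

(** Measurability is tested on every tuple space through [points], as for an RFS density.
    Nonnegativity is bundled in so that Tonelli and monotone convergence apply with no integrability
    condition. *)
Definition finset_measurable F :=
  (forall S, 0 <= F S) /\
  forall n, measurable_fun setT (fun t : n.-tuple E => F (points t)).

Definition point_integral A F S : \bar R := \int[mu]_(x in A) F (x |` S)%fset.

Lemma points_cons n x (t : n.-tuple E) :
  points [tuple of x :: t] = (x |` points t)%fset.
Proof. by rewrite /points fset_cons. Qed.

Lemma points_tuple0 (t : 0.-tuple E) : points t = fset0.
Proof. by rewrite tuple0 /points fset_nil. Qed.

Lemma points_surj S : exists n (t : n.-tuple E), S = points t.
Proof.
exists (size (enum_fset S)), (in_tuple (enum_fset S)).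
by apply/fsetP => x; rewrite !inE.
Qed.

Lemma measurable_pair_insert F n : finset_measurable F ->
  measurable_fun setT (fun p : E * n.-tuple E => F (p.1 |` points p.2)%fset).
Proof.
move=> [_ mF]; rewrite (_ : (fun _ => _) =
  (fun t => F (points t)) \o (fun p : E * n.-tuple E => [tuple of p.1 :: p.2])).
  apply: measurableT_comp; first exact: mF.
  exact: measurable_cons.
by apply/funext => p /=; rewrite points_cons.
Qed.

Lemma finset_measurable_insert F x : finset_measurable F ->
  finset_measurable (fun S => F (x |` S)%fset).
Proof.
move=> [F0 mF]; split=> // n.
have h := @measurable_pair_insert F n (conj F0 mF).
exact: (measurableT_comp h (pair1_measurable x)).
Qed.

(** The points of [S] are inserted one at a time, each insertion preserving measurability. *)
Lemma finset_measurable_setU F S : finset_measurable F ->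
  finset_measurable (fun S' => F (S `|` S')%fset).
Proof.
have [n [t ->]] := points_surj S.
elim: n t F => [|n IH] t F mF.
  by rewrite points_tuple0; under eq_fun do rewrite fset0U.
case/tupleP: t => x t; rewrite points_cons; under eq_fun do rewrite -fsetUA.
exact: (IH t (fun S => F (x |` S)%fset) (finset_measurable_insert x mF)).
Qed.

Lemma measurable_insert F S : finset_measurable F ->
  measurable_fun setT (fun x : E => F (x |` S)%fset).
Proof.
move=> mF; have [n [t ->]] := points_surj S.
exact: (measurableT_comp (@measurable_pair_insert F n mF)
  (pair2_measurable t)).
Qed.

(** Moves the domain into the integrand, since Tonelli is applied over the whole space. *)
Lemma point_integralE A F S : point_integral A F S =
  \int[mu]_x (if x \in A then F (x |` S)%fset else 0).
Proof. by rewrite /point_integral integral_mkcond. Qed.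

Lemma finset_measurable_point_integral A F : measurable A ->
  finset_measurable F -> finset_measurable (point_integral A F).
Proof.
move=> mA mF; split=> [S|n].
  by apply: integral_ge0 => x _; case: mF.
rewrite (_ : (fun _ => _) = fun t : n.-tuple E =>
    \int[mu]_x (if x \in A then F (x |` points t)%fset else 0)); last first.
  by apply/funext => t; exact: point_integralE.
apply: (@measurable_fun_fubini_tonelli_G _ _ E (n.-tuple E) R mu
  (fun p => if p.1 \in A then F (p.1 |` points p.2)%fset else 0)); last first.
  by move=> p /=; case: ifP => // _; case: mF.
apply: measurable_fun_ifT => //.
  exact: measurableT_comp (measurable_mem mA) (@measurable_fst _ _ _ _).
exact: measurable_pair_insert.
Qed.

Lemma finset_measurable_iter A F n : measurable A ->
  finset_measurable F -> finset_measurable (iter n (point_integral A) F).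
Proof.
by move=> mA mF; elim: n => //= n IH; exact: finset_measurable_point_integral.
Qed.

(** * Additivity and commutation of the point integrals *)

Lemma finset_measurableD F G : finset_measurable F -> finset_measurable G ->
  finset_measurable (fun S => F S + G S).
Proof.
move=> [F0 mF] [G0 mG]; split=> [S|n]; first exact: adde_ge0.
by apply: emeasurable_funD; [exact: mF|exact: mG].
Qed.

Lemma point_integralD A F G : measurable A ->
  finset_measurable F -> finset_measurable G ->
  point_integral A (fun S => F S + G S) =
  (fun S => point_integral A F S + point_integral A G S).
Proof.
move=> mA mF mG; apply/funext => S; apply: ge0_integralD => //.
- by move=> x _; case: mF.
- by apply: measurable_funTS; exact: measurable_insert.
- by move=> x _; case: mG.
- by apply: measurable_funTS; exact: measurable_insert.
Qed.

Lemma iter_point_integralD A F G n : measurable A ->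
  finset_measurable F -> finset_measurable G ->
  iter n (point_integral A) (fun S => F S + G S) =
  (fun S => iter n (point_integral A) F S + iter n (point_integral A) G S).
Proof.
move=> mA mF mG; elim: n => //= n ->; apply: point_integralD => //;
  exact: finset_measurable_iter.
Qed.

Lemma point_integral_setU A B F : measurable A -> measurable B ->
  A `&` B = set0 -> finset_measurable F ->
  point_integral (A `|` B) F =
  (fun S => point_integral A F S + point_integral B F S).
Proof.
move=> mA mB AB0 mF; apply/funext => S; apply: ge0_integral_setU => //.
- by apply: measurable_funTS; exact: measurable_insert.
- by move=> x _; case: mF.
- exact/disj_set2P.
Qed.

Lemma measurable_pair_insert2 F S : finset_measurable F ->
  measurable_fun setT (fun p : E * E => F (p.1 |` (p.2 |` S))%fset).
Proof.
move=> mF; have [n [t ->]] := points_surj S.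
rewrite (_ : (fun _ => _) = (fun t => F (points t)) \o
  (fun p : E * E => [tuple of p.1 :: [tuple of p.2 :: t]])).
  apply: measurableT_comp; first by case: mF => _; exact.
  apply: measurable_cons; first exact: measurable_fst.
  by apply: measurable_cons; [exact: measurable_snd|exact: measurable_cst].
by apply/funext => p /=; rewrite !points_cons.
Qed.

(** Tonelli's theorem, together with the fact that the order in which two points are inserted into a
    set is immaterial. *)
Lemma point_integralC A B F : measurable A -> measurable B ->
  finset_measurable F ->
  point_integral A (point_integral B F) = point_integral B (point_integral A F).
Proof.
move=> mA mB mF; apply/funext => S.
pose f (p : E * E) :=
  if p.1 \in A then if p.2 \in B then F (p.1 |` (p.2 |` S))%fset else 0 else 0.
have f0 p : 0 <= f p by rewrite /f; do 2 case: ifP => // _; case: mF.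
have mf : measurable_fun setT f.
  apply: measurable_fun_ifT => //.
    exact: measurableT_comp (measurable_mem mA) (@measurable_fst _ _ _ _).
  apply: measurable_fun_ifT => //; last exact: measurable_pair_insert2.
  exact: (measurableT_comp (measurable_mem mB) (@measurable_snd _ _ _ _)).
have fub := @fubini_tonelli _ _ E E R mu mu f mf f0.
rewrite [LHS]point_integralE [RHS](point_integralE B).
transitivity (\int[mu]_x \int[mu]_y f (x, y)).
  apply: eq_integral => x _; rewrite /f /=; case: ifP => _.
    rewrite point_integralE; apply: eq_integral => y _.
    by rewrite [in LHS]fsetUCA.
  by rewrite integral0.
rewrite fub; apply: eq_integral => y _; rewrite /f /=; case: ifP => _.
  by rewrite point_integralE.
by under eq_integral do rewrite if_same; rewrite integral0.
Qed.

Lemma iter_point_integralC A B F n : measurable A -> measurable B ->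
  finset_measurable F ->
  iter n (point_integral A) (point_integral B F) =
  point_integral B (iter n (point_integral A) F).
Proof.
move=> mA mB mF; elim: n => //= n ->.
by rewrite point_integralC//; exact: finset_measurable_iter.
Qed.

(** * Integrals over tuples as iterated point integrals *)

Lemma measurable_tuples_in n A : measurable A -> measurable (@tuples_in n A).
Proof.
move=> mA; rewrite (_ : tuples_in _ = \bigcap_(i in [set: 'I_n])
  ((fun t : n.-tuple E => tnth t i) @^-1` A)).
  apply: fin_bigcap_measurable => [|i _]; first exact: finite_finset.
  by rewrite -[X in measurable X]setTI; exact: measurable_tnth.
apply/seteqP; split=> t At i; first by move=> _; exact: At.
exact: (At i I).
Qed.

Lemma tuples_in_cons n A x (t : n.-tuple E) :
  tuples_in A [tuple of x :: t] <-> A x /\ tuples_in A t.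
Proof.
split=> [h|[Ax At] i].
  by split=> [|i]; [have := h ord0|have := h (lift ord0 i)]; rewrite ?tnthS.
by case: (unliftP ord0 i) => [j ->|->]; rewrite ?tnthS.
Qed.

(** The power measure is by construction a pushforward of a product under [pair_cons], so a change
    of variables and Tonelli suffice. *)
Lemma lebesgue_power_cons n (f : n.+1.-tuple E -> \bar R) :
  measurable_fun setT f -> (forall t, 0 <= f t) ->
  \int[lebesgue_power R d n.+1]_t f t =
  \int[mu]_x \int[lebesgue_power R d n]_t f [tuple of x :: t].
Proof.
move=> mf f0.
rewrite [LHS](@ge0_integral_pushforward _ _ (E * n.-tuple E)%type (n.+1.-tuple E)
   _ (@pair_cons _ E n) (@measurable_pair_cons _ E n)
   (mu \x lebesgue_power R d n))//.
rewrite preimage_setT fubini_tonelli1//.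
  exact: (measurableT_comp mf (@measurable_pair_cons _ E n)).
by move=> p; exact: f0.
Qed.

Lemma integral_tuples A F n S : measurable A -> finset_measurable F ->
  \int[lebesgue_power R d n]_(t in tuples_in A) F (S `|` points t)%fset =
  iter n (point_integral A) F S.
Proof.
move=> mA; elim: n S F => [|n IH] S F mF.
  have [_ /(_ 0%N) mFS] := finset_measurable_setU S mF.
  rewrite integral_dirac; last exact: measurable_funTS.
    by rewrite points_tuple0 fsetU0 diracE mem_set ?mul1e// => -[].
  exact: measurable_tuples_in.
have [FS0 mFS] := finset_measurable_setU S mF.
rewrite integral_mkcond lebesgue_power_cons; last 2 first.
- apply: (measurable_restrictT _ (measurable_tuples_in mA)).1.
  exact: measurable_funTS (mFS n.+1).
- by move=> t; rewrite erestrict_ge0.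
rewrite iterS [RHS]point_integralE; apply: eq_integral => x _.
case: ifPn => [xA|xA].
  rewrite -(IH _ F mF) [RHS]integral_mkcond; apply: eq_integral => t _.
  rewrite !patchE points_cons fsetUCA fsetUA.
  have -> : ([tuple of x :: t] \in tuples_in A) = (t \in tuples_in A) => //.
  apply/idP/idP; rewrite !inE tuples_in_cons; first by case.
  by split=> //; rewrite inE in xA.
apply: integral0_eq => t _; rewrite patchE ifF//.
by apply/negbTE; apply: contra xA; rewrite !inE tuples_in_cons => -[].
Qed.

Lemma set_integralE A F : measurable A -> finset_measurable F -> forall S,
  set_integral A (fun S' => F (S `|` S')%fset) =
  \sum_(0 <= n <oo) ((n`!%:R)^-1)%:E * iter n (point_integral A) F S.
Proof.
move=> mA mF S; apply: eq_eseriesr => n _; congr (_ * _).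
exact: integral_tuples.
Qed.

End finset_functions.

(** * Binomial expansion of the iterates for a disjoint union *)

Section decomposition.
Variables (R : realType) (d : nat).
Local Notation E := (euclidean R d).
Implicit Types (F G : {fset E} -> \bar R) (S : {fset E}) (A B : set E).

Lemma iter_point_integral_setU A B F n : measurable A -> measurable B ->
  A `&` B = set0 -> finset_measurable F ->
  iter n.+1 (point_integral (A `|` B)) F =
  (fun S => iter n (point_integral (A `|` B)) (point_integral A F) S +
            iter n (point_integral (A `|` B)) (point_integral B F) S).
Proof.
move=> mA mB AB0 mF; rewrite iterSr point_integral_setU//.
apply: iter_point_integralD; first exact: measurableU.
all: exact: finset_measurable_point_integral.
Qed.

Lemma iter_point_integral_ge0 A B F k m S : measurable A -> measurable B ->
  finset_measurable F ->
  0 <= iter k (point_integral A) (iter m (point_integral B) F) S.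
Proof.
move=> mA mB mF.
by have [] := finset_measurable_iter k mA (finset_measurable_iter m mB mF).
Qed.

(** The left side is one term of the expansion of a power of T_A + T_B; the other terms are
    nonnegative. The proof follows Pascal's rule. *)
Lemma binomial_point_integral_le A B F k m S :
  measurable A -> measurable B -> A `&` B = set0 -> finset_measurable F ->
  ('C(k + m, k)%:R)%:E *
    iter k (point_integral A) (iter m (point_integral B) F) S <=
  iter (k + m) (point_integral (A `|` B)) F S.
Proof.
move=> mA mB AB0; have mAB : measurable (A `|` B) by exact: measurableU.
(* The induction on [k + m] generalizes [F], since peeling off the innermost operator replaces [F]
   by T_A F or T_B F. *)
have [n] := ubnP (k + m); elim: n => // n IH in k m F *.
move=> kmn mF.
have mAF := finset_measurable_point_integral mA mF.
have mBF := finset_measurable_point_integral mB mF.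
have IHA k' : (k' + m < n)%N -> ('C(k' + m, k')%:R)%:E *
    iter k'.+1 (point_integral A) (iter m (point_integral B) F) S <=
    iter (k' + m) (point_integral (A `|` B)) (point_integral A F) S.
  move=> lt; rewrite iterSr -iter_point_integralC//; exact: IH.
have IHB m' : (k + m' < n)%N -> ('C(k + m', k)%:R)%:E *
    iter k (point_integral A) (iter m'.+1 (point_integral B) F) S <=
    iter (k + m') (point_integral (A `|` B)) (point_integral B F) S.
  move=> lt; rewrite iterSr; exact: IH.
(* When exactly one exponent is zero, only one summand is bounded below by induction; the other is
   dropped as nonnegative. *)
case: k m kmn IHA IHB => [|k] [|m] kmn IHA IHB; first by rewrite mul1e.
- have := IHB m; rewrite !bin0 !add0n => IHBm.
  rewrite iter_point_integral_setU//; apply: le_trans (IHBm kmn) _.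
  by apply: leeDr; case: (finset_measurable_iter m mAB mAF).
- have := IHA k; rewrite !addn0 !binn in kmn * => IHAk.
  rewrite iter_point_integral_setU//; apply: le_trans (IHAk kmn) _.
  by apply: leeDl; case: (finset_measurable_iter k mAB mBF).
- rewrite addSn binS natrD EFinD ge0_muleDl ?lee_fin//.
  rewrite iter_point_integral_setU// addeC; apply: leeD.
    exact: IHA.
  by rewrite addnS -addSn; apply: IHB; rewrite addSn -addnS.
Qed.

(** By commutation, the vanishing of all mixed iterates passes from [F] to T_A F and T_B F, so
    induction applies to both. *)
Lemma iter_point_integral_eq0 A B F n S :
  measurable A -> measurable B -> A `&` B = set0 -> finset_measurable F ->
  (forall k m, iter k (point_integral A) (iter m (point_integral B) F) S = 0) ->
  iter n (point_integral (A `|` B)) F S = 0.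
Proof.
move=> mA mB AB0; elim: n => [|n IH] in F *; first by move=> _ /(_ 0%N 0%N).
move=> mF F0; rewrite iter_point_integral_setU// !IH ?adde0//.
- exact: finset_measurable_point_integral.
- by move=> k m; rewrite -iterSr; exact: (F0 k m.+1).
- exact: finset_measurable_point_integral.
- by move=> k m; rewrite iter_point_integralC// -iterSr; exact: (F0 k.+1 m).
Qed.

(** * Series of iterated point integrals *)

Lemma finset_measurableZ (r : R) F : (0 <= r)%R -> finset_measurable F ->
  finset_measurable (fun S => r%:E * F S).
Proof.
move=> r0 [F0 mF]; split=> [S|n]; first by rewrite mule_ge0// lee_fin.
exact: measurable_funeM (mF n).
Qed.

Lemma finset_measurable_nneseries (F : nat -> {fset E} -> \bar R) :
  (forall n, finset_measurable (F n)) ->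
  finset_measurable (fun S => \sum_(0 <= n <oo) F n S).
Proof.
move=> mF; split=> [S|n].
  by apply: nneseries_ge0 => i _ _; case: (mF i).
apply: ge0_emeasurable_sum => [k t _ _|k _]; first exact: (mF k).1.
exact: (mF k).2.
Qed.

Lemma iter_point_integral_nneseries A (c : nat -> R)
    (F : nat -> {fset E} -> \bar R) k :
  measurable A -> (forall n, (0 <= c n)%R) ->
  (forall n, finset_measurable (F n)) ->
  iter k (point_integral A) (fun S => \sum_(0 <= n <oo) (c n)%:E * F n S) =
  (fun S => \sum_(0 <= n <oo) (c n)%:E * iter k (point_integral A) (F n) S).
Proof.
move=> mA c0 mF; elim: k => //= k ->; apply/funext => S.
have mkF n := finset_measurable_iter k mA (mF n).
have mckF n := finset_measurableZ (c0 n) (mkF n).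
rewrite {1}/point_integral integral_nneseries//; last 2 first.
- by move=> n; apply: measurable_funTS; exact: (measurable_insert S (mckF n)).
- by move=> n x _; case: (mckF n).
apply: eq_eseriesr => n _; rewrite ge0_integralZl_EFin//.
- by move=> x _; case: (mkF n).
- by apply: measurable_funTS; exact: measurable_insert.
Qed.

(** By the binomial bound, the term of index [m] on the left is at most [k!] times the term of index
    [m + k] on the right. *)
Lemma iter_point_integral_series_le A B F k S :
  measurable A -> measurable B -> A `&` B = set0 -> finset_measurable F ->
  iter k (point_integral A)
    (fun S => \sum_(0 <= m <oo) ((m`!%:R)^-1)%:E *
                iter m (point_integral B) F S) S <=
  (k`!%:R)%:E * \sum_(0 <= n <oo) ((n`!%:R)^-1)%:E *
                  iter n (point_integral (A `|` B)) F S.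
Proof.
move=> mA mB AB0 mF.
rewrite iter_point_integral_nneseries//; last first.
  by move=> m; exact: finset_measurable_iter.
set a := fun n => ((n`!%:R)^-1)%:E * iter n (point_integral (A `|` B)) F S.
have a0 n : 0 <= a n.
  rewrite /a mule_ge0 ?lee_fin//.
  by have [] := finset_measurable_iter n (measurableU _ _ mA mB) mF.
apply: (@le_trans _ _ ((k`!%:R)%:E * \sum_(0 <= m <oo) a (m + k)%N)).
  rewrite -nneseriesZl//; apply: lee_nneseries => [m _ _|m _].
    by rewrite mule_ge0 ?lee_fin// iter_point_integral_ge0.
  have -> : ((m`!%:R)^-1 = k`!%:R / (k + m)`!%:R * 'C(k + m, k)%:R :> R)%R.
    rewrite -(bin_fact (leq_addr m k)) addKn !natrM; field.
    by rewrite !pnatr_eq0 -!lt0n bin_gt0 leq_addr !fact_gt0.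
  rewrite /a (addnC m k) EFinM -muleA [leRHS]muleA -EFinM.
  apply: lee_wpmul2l; first by rewrite lee_fin divr_ge0.
  exact: binomial_point_integral_le.
rewrite lee_pmul2l//; rewrite ?lte_fin ?ltr0n ?fact_gt0//.
(* The shifted series is the full one without its first [k] terms, which are nonnegative. *)
rewrite nneseries_addn// [leRHS](nneseries_split 0 k)//.
  by apply: leeDr; apply: sume_ge0 => i _; exact: a0.
by move=> n _; exact: a0.
Qed.

End decomposition.

(** * Restricting a finite set to a measurable region *)

Section restriction.
Variables (R : realType) (d : nat).
Local Notation E := (euclidean R d).
Implicit Types (F G : {fset E} -> \bar R) (S : {fset E}) (A B : set E).

Lemma fset_restrict1U x S A : fset_restrict (x |` S)%fset A =
  (if x \in A then x |` fset_restrict S A else fset_restrict S A)%fset.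
Proof.
apply/fsetP => y; case: ifPn => xA; rewrite !inE/=.
  by case: eqVneq => [->|]//=; rewrite xA.
by case: eqVneq => [->|]//=; rewrite (negbTE xA) andbF.
Qed.

Lemma fset_restrict0 A : fset_restrict (fset0 : {fset E}) A = fset0.
Proof. by apply/fsetP => x; rewrite !inE. Qed.

Lemma fset_restrictK A B S : A `|` B = setT ->
  (fset_restrict S B `|` fset_restrict S A)%fset = S.
Proof.
move=> AB; apply/fsetP => x; rewrite !inE/= -andb_orr orbC.
suff -> : (x \in A) || (x \in B) by rewrite andbT.
by have : (A `|` B) x by [rewrite AB]; case=> h; rewrite (mem_set h) ?orbT.
Qed.

Lemma set_power_indic_restrict A S : set_power \1_A (fset_restrict S A) = 1%R.
Proof.
rewrite /set_power big_seq big1// => x; rewrite !inE/= => /andP[_ xA].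
by rewrite indicE xA.
Qed.

Lemma fset_restrict_setU_tuples A B k m (t : k.-tuple E) (v : m.-tuple E) :
  A `&` B = set0 -> tuples_in A t -> tuples_in B v ->
  fset_restrict (points t `|` points v)%fset A = points t.
Proof.
move=> AB0 At Bv; apply/fsetP => x; rewrite !inE/=.
apply/idP/idP => [/andP[/orP[//|/tnthP[i xv]] /set_mem xA]|xt].
  have : (A `&` B) x by split=> //; rewrite xv; exact: Bv.
  by rewrite AB0.
by have /tnthP[i ->] := xt; rewrite mem_tnth/= mem_set//; exact: At.
Qed.

(* z.1 accumulates the points found in A while z.2 is scanned by induction. *)
Lemma measurable_points_restrict A F n q : measurable A -> finset_measurable F ->
  measurable_fun setT (fun z : q.-tuple E * n.-tuple E =>
    F (points z.1 `|` fset_restrict (points z.2) A)%fset).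
Proof.
move=> mA [F0 mF]; elim: n q => [|n IH] q.
  rewrite (_ : (fun _ => _) = (fun t => F (points t)) \o fst).
    exact: measurableT_comp (mF q) (@measurable_fst _ _ _ _).
  by apply/funext => z /=; rewrite points_tuple0 fset_restrict0 fsetU0.
pose hd (z : q.-tuple E * n.+1.-tuple E) : E := tnth z.2 ord0.
pose tl (z : q.-tuple E * n.+1.-tuple E) : n.-tuple E := [tuple of behead z.2].
have mhd : measurable_fun setT hd.
  exact: measurableT_comp (@measurable_tnth _ E _ ord0) (@measurable_snd _ _ _ _).
have mtl : measurable_fun setT tl.
  exact: measurableT_comp (@measurable_behead _ E n) (@measurable_snd _ _ _ _).
rewrite (_ : (fun _ => _) = fun z => if hd z \in A then
    F (points [tuple of hd z :: z.1] `|` fset_restrict (points (tl z)) A)%fset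
  else F (points z.1 `|` fset_restrict (points (tl z)) A)%fset).
  apply: measurable_fun_ifT.
  - exact: measurableT_comp (measurable_mem mA) mhd.
  - apply: (measurableT_comp (IH q.+1)
      (g := fun z => ([tuple of hd z :: z.1], tl z))).
    apply: measurable_fun_pair => //.
    by apply: measurable_cons => //; exact: measurable_fst.
  - apply: (measurableT_comp (IH q) (g := fun z => (z.1, tl z))).
    by apply: measurable_fun_pair => //; exact: measurable_fst.
apply/funext => -[u t] /=; rewrite /hd /tl /=; case/tupleP: t => x t.
have -> : [tuple of behead [tuple of x :: t]] = t by exact: val_inj.
rewrite tnth0 !points_cons fset_restrict1U; case: ifP => // _.
by rewrite fsetUCA fsetUA.
Qed.

Lemma finset_measurable_restrict A F : measurable A -> finset_measurable F ->
  finset_measurable (fun S => F (fset_restrict S A)).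
Proof.
move=> mA mF; split=> [S|n]; first by case: mF.
(* The scan starts from an empty accumulator. *)
rewrite (_ : (fun _ => _) = (fun z : 0.-tuple E * n.-tuple E =>
    F (points z.1 `|` fset_restrict (points z.2) A)%fset) \o pair [tuple]).
  exact: measurableT_comp (@measurable_points_restrict A F n 0 mA mF)
    (pair1_measurable _).
by apply/funext => t /=; rewrite points_tuple0 fset0U.
Qed.

End restriction.

(** * The decomposition of the density *)

Lemma marginal_density_restrict (R : realType) (d : nat)
    (W V : set (euclidean R d)) (pi : {fset euclidean R d} -> R) S :
  marginal_density W V pi (fset_restrict S W) =
  set_integral V (fun S' => (pi (fset_restrict S W `|` S')%fset)%:E).
Proof. by rewrite /marginal_density set_power_indic_restrict mul1e. Qed.

(** A finite nonzero marginal cancels. At 0 the convention makes the conditional density 1, and at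
    +oo its numerator is [pi S]; in both cases [pi S = 0] makes both sides zero. *)
Lemma decomposition_off_null (R : realType) (d : nat)
    (W V : set (euclidean R d)) (pi : {fset euclidean R d} -> R) S :
  W `|` V = setT ->
  (marginal_density W V pi (fset_restrict S W) \in [:: 0; +oo] -> pi S = 0%R) ->
  0 <= marginal_density W V pi (fset_restrict S W) ->
  (pi S)%:E = conditional_density W V pi (fset_restrict S V) (fset_restrict S W)
    * marginal_density W V pi (fset_restrict S W).
Proof.
move=> WV h m0; rewrite /conditional_density.
case: eqVneq => [m_eq0|m_neq0].
  by rewrite m_eq0 mule0 h// m_eq0 inE eqxx.
rewrite !set_power_indic_restrict !mul1r fset_restrictK//.
move: h m0 m_neq0; case: (marginal_density _ _ _ _) => [r| |] h m0 m_neq0 //.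
  have r0 : r != 0%R by apply: contra m_neq0 => /eqP ->.
  by rewrite inver (negbTE r0) -!EFinM divfK.
by rewrite h ?mul0e// !inE eqxx orbT.
Qed.

Theorem proposition2 (R : realType) (d : nat)
    (dO : measure_display) (Omega : measurableType dO)
    (P : probability Omega R) (X : {RV P >-> finset_space R d})
    (pi : {fset euclidean R d} -> R)
    (hpi : is_rfs_density X pi)
    (W V : set (euclidean R d))
    (mW : measurable W) (mV : measurable V)
    (WV0 : W `&` V = set0) (WVT : W `|` V = setT) :
  ae_finset (fun S : {fset euclidean R d} =>
    (pi S)%:E =
      conditional_density W V pi (fset_restrict S V) (fset_restrict S W)
        * marginal_density W V pi (fset_restrict S W)).
Proof.
case: hpi => pi0 mpi Ppi.
pose F (S : {fset euclidean R d}) := (pi S)%:E.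
have mF : finset_measurable F.
  by split=> [S|n]; [rewrite lee_fin|apply/measurable_EFinP; exact: mpi].
pose G (S : {fset euclidean R d}) := \sum_(0 <= m <oo) ((m`!%:R)^-1)%:E *
  iter m (point_integral V) F S.
have GE S : G S = set_integral V (fun S' => F (S `|` S')%fset).
  by rewrite set_integralE.
have mG : finset_measurable G.
  apply: finset_measurable_nneseries => m.
  by apply: finset_measurableZ => //; exact: finset_measurable_iter.
have Goo k : iter k (point_integral W) G fset0 < +oo.
  apply: le_lt_trans (iter_point_integral_series_le _ _ _ _ _ _) _ => //.
  (* The series is now the integral of [pi] over all finite sets, the probability of [X] lying in
     the whole space. *)
  rewrite WVT -set_integralE//.
  under [X in set_integral _ X]eq_fun do rewrite fset0U.
  rewrite -Ppi// (_ : [set w | _] = setT); last by apply/seteqP; split.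
  by rewrite probability_setT mule1 ltry.
pose f (S : {fset euclidean R d}) :=
  if (G (fset_restrict S W) == 0) || (G (fset_restrict S W) == +oo)
  then F S else 0.
have mf : finset_measurable f.
  split=> [S|n]; first by rewrite /f; case: ifP => // _; case: mF.
  have [_ /(_ n) mGr] := finset_measurable_restrict mW mG.
  apply: measurable_fun_ifT => //; last exact: mF.2.
  by apply: measurable_or; apply: measurable_fun_eqe.
have f_off k m (t : k.-tuple (euclidean R d)) : tuples_in W t ->
    G (points t) < +oo -> iter m (point_integral V) f (points t) = 0.
  move=> Wt Gt; rewrite -integral_tuples//.
  (* Adding points of [V] leaves the restriction to [W] unchanged, so the test in [f] depends on [t]
     alone: [f] is either 0 on all of V^m or equal to [F] there. *)
  have [Gt0|Gt0] := eqVneq (G (points t)) 0; last first.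
    apply: integral0_eq => v Vv; rewrite /f (fset_restrict_setU_tuples WV0)//.
    by rewrite (negbTE Gt0)/= lt_eqF.
  transitivity (iter m (point_integral V) F (points t)).
    rewrite -integral_tuples//; apply: eq_integral => v /set_mem Vv.
    by rewrite /f (fset_restrict_setU_tuples WV0)// Gt0 eqxx.
  have H0 i : 0 <= ((i`!%:R)^-1)%:E * iter i (point_integral V) F (points t).
    rewrite mule_ge0 ?lee_fin//.
    by case: (finset_measurable_iter i mV mF).
  (* A nonnegative series with sum 0 has a zero term at [m], and the factor 1/m! is nonzero. *)
  move: Gt0; rewrite /G (@nneseriesD1 _ _ m)// => /eqP.
  rewrite padde_eq0//; last by apply: nneseries_ge0.
  move=> /andP[/eqP + _]; move/eqP; rewrite mule_eq0 => /orP[|/eqP//].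
  by rewrite eqe invr_eq0 pnatr_eq0 (negbTE (lt0n_neq0 (fact_gt0 m))).
have f0 k m :
    iter k (point_integral W) (iter m (point_integral V) f) fset0 = 0.
  have mVf := finset_measurable_iter m mV mf.
  have mfk := (mVf.2 k).
  rewrite -integral_tuples//; under eq_integral do rewrite fset0U.
  rewrite -(@integral0 _ _ _ (lebesgue_power R d k) (tuples_in W)).
  apply: ge0_ae_eq_integral => //.
  - exact: measurable_tuples_in.
  - exact: measurable_funTS.
  - by move=> t _; case: mVf.
  (* [Goo] makes [G] integrable over W^k, so [f_off] applies at almost every tuple. *)
  have : {ae lebesgue_power R d k,
      forall t, tuples_in W t -> G (points t) \is a fin_num}.
    apply: integrable_ae; first exact: measurable_tuples_in.
    apply/integrableP; split; first exact: measurable_funTS (mG.2 k).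
    apply: le_lt_trans (Goo k); rewrite -integral_tuples// le_eqVlt.
    apply/orP; left; apply/eqP/eq_integral => t _.
    by rewrite fset0U gee0_abs//; exact: mG.1.
  apply: filterS => t Gt Wt; rewrite f_off//.
  by rewrite ltey_eq Gt.
move=> n.
have := iter_point_integral_eq0 n mW mV WV0 mf f0.
have mfn := mf.2 n.
rewrite WVT -integral_tuples//.
have -> : tuples_in setT = setT :> set (n.-tuple (euclidean R d)).
  by apply/seteqP; split.
(* Being nonnegative, [f] is its own absolute value, so its zero integral forces it to vanish almost
   everywhere. *)
under eq_integral do rewrite fset0U -[f _]gee0_abs ?mf.1//.
move=> /(ae_eq_integral_abs _ measurableT mfn); apply: filterS => t /(_ I) ft0.
apply: decomposition_off_null => //; rewrite marginal_density_restrict -GE.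
  (* Where the marginal is 0 or +oo, [f] agrees with [pi], so [pi] is zero there. *)
  rewrite !inE => Gt; move: ft0; rewrite /f Gt => -[//].
by case: mG.
Qed.
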